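(* Let $n\ge2$ and let $A=(A_1,\dots,A_n)$ be an admissible tuple of invertible Hermitian $k\times k$ matrices. Let $Q_{\mathcal{A}_1(A)}=\widetilde{R}_1^{t_1}\cdots\widetilde{R}_m^{t_m}$ be the factorization of the joint characteristic polynomial of the extension $\mathcal{A}_1(A)$ into powers of distinct irreducible polynomials. If the extension $A\subset\mathcal{A}_1(A)$ is spectrally stable and not all $t_j$ are equal to $1$, then the tuple $A$ is reducible.
   Context: For a tuple $B=(B_1,\dots,B_N)$ of $k\times k$ matrices put $B_*(z)=z_1B_1+\cdots+z_NB_N$ and $Q_B(z_0,z)=\det(z_0I+B_*(z))$, with factorization $Q_B=\prod_{j}R_j(z_0,z)^{t_j}$ into powers of distinct irreducible polynomials. Let $\sigma_p(B)=\{z\in\mathbb{C}^N:\det(I-B_*(z))=0\}$; its components are $\Gamma_j=\{z: R_j(-1,z)=0\}$. Put $p_B(z)=\prod_jR_j(-1,z)$ and let $L_i\subset\mathbb{C}^N$ be the $i$-th coordinate line. $B$ is admissible if for each $1\le i\le N$ and each $\lambda\in\sigma_p(B)\cap L_i$ one has $\frac{\partial p_B}{\partial z_i}(\lambda)\neq0$. $\mathfrak{A}(A)$ is the unital algebra generated by $A_1,\dots,A_n$; an algebraic extension of $A$ is a tuple $\widetilde{A}=(A_1,\dots,A_n,A_{n+1},\dots,A_N)$ with $N>n$ and $A_{n+1},\dots,A_N\in\mathfrak{A}(A)$. Given an admissible tuple $A$ of invertible matrices and an algebraic extension $\widetilde{A}$ with $Q_{\widetilde{A}}=\prod_j\widetilde{R}_j^{t_j}$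 and components $\widetilde{\Gamma}_j=\{z\in\mathbb{C}^N:\widetilde{R}_j(-1,z)=0\}$, the extension $A\subset\widetilde{A}$ is spectrally stable if for every $1\le i\le n$ and every eigenvalue $\lambda$ of $A_i$, the point $\widetilde{\tau}=(0,\dots,0,1/\lambda,0,\dots,0)\in\mathbb{C}^N$ ($1/\lambda$ in position $i$) belongs to a single component $\widetilde{\Gamma}_m$ and the partial derivative of $\widetilde{R}_m(-1,z)$ with respect to $z_i$ at $\widetilde{\tau}$ does not vanish. The extension $\mathcal{A}_1(A)$: let $\lambda_1,\dots,\lambda_r$ be the distinct eigenvalues of $A_1$ and $\mathcal{P}_j$ the orthogonal projection onto the $\lambda_j$-eigenspace of $A_1$. For $1\le q\le r$, $I=(i_1,\dots,i_q)$ with $2\le i_1,\dots,i_q\le n$, and $J=(j_1,\dots,j_{q-1})$ with pairwise distinct entries in $\{1,\dots,r\}$ ($J=\emptyset$ if $q=1$), let $W_{IJ}=A_{i_1}\mathcal{P}_{j_1}A_{i_2}\mathcal{P}_{j_2}\cdots A_{i_{q-1}}\mathcal{P}_{j_{q-1}}A_{i_q}$. Then $\mathcal{A}_1(A)$ is the tuple consisting of $A_1,\dots,A_n$ followed by all the remaining $W_{IJ}$ (those with $q\ge2$). A tuple is reducible if it has a common reducing subspace other than $0$ and $\mathbb{C}^k$ (for Hermitian tuples every common invariant subspace is reducing). *)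

(* Defs.v *)
From mathcomp Require Import all_boot all_order all_algebra.
From mathcomp Require Import sesquilinear spectral.
From mathcomp Require Import mpoly complex.
From mathcomp Require Import reals.
Set Implicit Arguments.
Unset Strict Implicit.
Unset Printing Implicit Defensive.
Import Order.TTheory GRing.Theory Num.Theory.
Local Open Scope ring_scope.
Local Open Scope sesquilinear_scope.

(* Matrices act on column vectors.  A tuple of N matrices is an
   N.-tuple; its polynomials live in N.+1 variables, where index ord0 is z_0
   and lift ord0 i is the variable attached to the i-th matrix. *)

Definition joint_charpoly (C : numClosedFieldType) (k N : nat)
    (B : N.-tuple 'M[C]_k) : {mpoly C[N.+1]} :=
  \det ('X_ord0 *: 1%:M
        + \sum_(i < N) 'X_(lift ord0 i) *: map_mx (@mpolyC N.+1 C) (tnth B i)).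

(* Being a unit of {mpoly C[n]} means being a nonzero constant. *)
Definition mirreducible (C : numClosedFieldType) (n : nat)
    (p : {mpoly C[n]}) : Prop :=
  [/\ p != 0, p \isn't a GRing.unit
    & forall a b : {mpoly C[n]},
        p = a * b -> a \is a GRing.unit \/ b \is a GRing.unit].

(* Irreducible factors are taken up to scalars, so "distinct" means pairwise
   non-proportional; a scalar in front of the product can be absorbed in one
   of the factors since C is algebraically closed. *)
Definition is_factorization (C : numClosedFieldType) (n m : nat)
    (p : {mpoly C[n]}) (F : 'I_m -> {mpoly C[n]}) (t : 'I_m -> nat) : Prop :=
  [/\ p = \prod_(j < m) F j ^+ t j,
      forall j, mirreducible (F j),
      forall j, (0 < t j)%N
    & forall i j (c : C), F i = c *: F j -> i = j].

(* The polynomial p(-1, z) in the remaining variables. *)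
Definition dehom (C : numClosedFieldType) (N : nat) (p : {mpoly C[N.+1]}) :
    {mpoly C[N]} :=
  p \mPo [tuple if unlift ord0 i is Some j then 'X_j else -1 | i < N.+1].

Definition axis_point (C : numClosedFieldType) (N : nat) (i : 'I_N) (c : C) :
    'I_N -> C :=
  fun j => if j == i then c else 0.

Definition proper_joint_spectrum (C : numClosedFieldType) (k N : nat)
    (B : N.-tuple 'M[C]_k) (z : 'I_N -> C) : Prop :=
  \det (1%:M - \sum_(i < N) z i *: tnth B i) = 0.

Definition component (C : numClosedFieldType) (N : nat) (p : {mpoly C[N.+1]})
    (z : 'I_N -> C) : Prop :=
  (dehom p).@[z] = 0.

(* The factorization is unique up to order and nonzero scalars, and the
   condition does not depend on these. *)
Definition admissible (C : numClosedFieldType) (k N : nat)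
    (B : N.-tuple 'M[C]_k) : Prop :=
  exists (m : nat) (F : 'I_m -> {mpoly C[N.+1]}) (t : 'I_m -> nat),
    is_factorization (joint_charpoly B) F t /\
    forall (i : 'I_N) (c : C),
      proper_joint_spectrum B (axis_point i c) ->
      ((\prod_(j < m) dehom (F j))^`M(i)).@[axis_point i c] != 0.

(* Stability of A inside an extension by s further matrices, expressed through
   the irreducible factors F of the joint characteristic polynomial of the
   extension; lshift s i is the position of the i-th matrix of A there. *)
Definition spectrally_stable (C : numClosedFieldType) (k n s m : nat)
    (A : n.-tuple 'M[C]_k) (F : 'I_m -> {mpoly C[(n + s).+1]}) : Prop :=
  forall (i : 'I_n) (lam : C), eigenvalue (tnth A i) lam ->
    let tau := axis_point (lshift s i) lam^-1 in
    exists j : 'I_m,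
      [/\ component (F j) tau,
          forall l, component (F l) tau -> l = j
        & ((dehom (F j))^`M(lshift s i)).@[tau] != 0].

Definition distinct_eigenvalues (C : numClosedFieldType) (k r : nat)
    (M : 'M[C]_k) (lam : r.-tuple C) : Prop :=
  uniq lam /\ forall a : C, (a \in lam) = eigenvalue M a.

(* Orthogonal projection onto the column space {x | M *m x = a *: x}.
   eigenspace and proj_ortho deal with row vectors, hence the transpositions. *)
Definition eigenproj (C : numClosedFieldType) (k : nat) (M : 'M[C]_k) (a : C) :
    'M[C]_k :=
  (proj_ortho (eigenspace M^T a))^T.

(* A_{i_1} P_{j_1} A_{i_2} ... P_{j_(q-1)} A_{i_q}, for size u = (size v).+1 *)
Fixpoint wordmx (C : numClosedFieldType) (k n r : nat) (A : n.-tuple 'M[C]_k)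
    (P : 'I_r -> 'M[C]_k) (u : seq 'I_n) (v : seq 'I_r) : 'M[C]_k :=
  match u, v with
  | i :: u', j :: v' => tnth A i *m P j *m wordmx A P u' v'
  | i :: _, [::] => tnth A i
  | [::], _ => 1%:M
  end.

(* All words with 2 <= q <= r; A`_0 is the first matrix of A, and the letters
   of u avoid its index. *)
Definition extension_words (C : numClosedFieldType) (k n r : nat)
    (A : n.-tuple 'M[C]_k) (lam : r.-tuple C) : seq 'M[C]_k :=
  flatten [seq
    [seq wordmx A (fun j => eigenproj A`_0 (tnth lam j)) (tval u) (tval v)
       | u <- [seq u : q.-tuple 'I_n <- enum predT
                 | all (fun i : 'I_n => 0 < i)%N u],
         v <- [seq v : q.-1.-tuple 'I_r <- enum predT | uniq v]]
    | q <- iota 2 r.-1].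

Definition ext1 (C : numClosedFieldType) (k n r : nat)
    (A : n.-tuple 'M[C]_k) (lam : r.-tuple C) :
    (n + size (extension_words A lam)).-tuple 'M[C]_k :=
  [tuple of A ++ in_tuple (extension_words A lam)].

Definition reducible (C : numClosedFieldType) (k n : nat)
    (A : n.-tuple 'M[C]_k) : Prop :=
  exists U : {vspace 'cV[C]_k},
    [/\ U != 0%VS, U != fullv
      & forall (i : 'I_n) (x : 'cV[C]_k), x \in U ->
          tnth A i *m x \in U /\ (tnth A i)^t* *m x \in U].

(* Main.v *)
From HB Require Import structures.
Require Import Defs.
From mathcomp Require Import all_boot all_order all_algebra.
From mathcomp Require Import sesquilinear spectral.
From mathcomp Require Import mpoly complex.
From mathcomp Require Import reals.
From mathcomp Require Import zify ring.
Set Implicit Arguments.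
Unset Strict Implicit.
Unset Printing Implicit Defensive.
Import Order.TTheory GRing.Theory Num.Theory.
Local Open Scope ring_scope.
Local Open Scope sesquilinear_scope.

(* Let P_l be the spectral projections of A_1.  Spectral stability makes the
   joint characteristic polynomial of the extension near the point 1/lambda_l of
   the first axis a t-th power of a function with nonzero derivative, so to first
   order all the eigenvalues of P_l H P_l on the range of P_l agree and
   t = rank P_l, for every H in the span of the extended tuple.  As the tuple
   contains the adjoint of each of its members W, the compressions P_l W P_l are
   scalar.  Cutting loops, P_l w P_l is then a scalar multiple of P_l for every
   word w in the A_i and the P_j.  Each factor R_j is homogeneous, hence meets the
   first axis at some 1/lambda_l; if t_j > 1 then rank P_l > 1, and for a nonzero
   x in the range of P_l the span of all the w x meets that range only in the
   line through x, so it is a proper common invariant subspace. *)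

(** * Determinants and monomials *)

(** Sylvester's identity: one block matrix factors in two ways into block triangular matrices, and
    the determinants are compared. *)
Lemma det_addmulC (R : comNzRingType) (m n : nat) (A : 'M[R]_(m, n))
    (B : 'M[R]_(n, m)) :
  \det (1%:M + A *m B) = \det (1%:M + B *m A).
Proof.
have eq1 : block_mx 1%:M 0 B 1%:M *m block_mx 1%:M (- A) 0 (1%:M + B *m A)
    = block_mx 1%:M (- A) B 1%:M.
  rewrite mulmx_block !(mul1mx, mulmx1, mul0mx, mulmx0, add0r, addr0).
  by congr block_mx; rewrite mulmxN addrCA addNr addr0.
have eq2 : block_mx (1%:M + A *m B) (- A) 0 1%:M *m block_mx 1%:M 0 B 1%:M
    = block_mx 1%:M (- A) B 1%:M.
  rewrite mulmx_block !(mul1mx, mulmx1, mul0mx, mulmx0, add0r, addr0).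
  by congr block_mx; rewrite mulNmx addrK.
have := congr1 (fun M => \det M) (etrans eq1 (esym eq2)).
by rewrite !det_mulmx !det_lblock !det_ublock !det1 !mul1r !mulr1 => <-.
Qed.

(** Through [P = col_base P *m row_base P], Sylvester's identity moves the determinant to size
    [\rank P], where the matrix is ['X] times the identity. *)
Lemma det_scale_idempotent (F : fieldType) (k : nat) (P : 'M[F]_k) :
  P *m P = P ->
  \det (1%:M + ('X - 1) *: map_mx polyC P) = 'X^(\rank P) :> {poly F}.
Proof.
move=> PP.
(* With P = C R, idempotence reads C R C R = C R; C cancels on the left and R on the right. *)
have RC : row_base P *m col_base P = 1%:M.
  apply: (row_full_inj (col_base_full P)); apply: (row_free_inj (row_base_free P)).
  by rewrite mulmx1 mulmx_base -mulmxA mulmxA mulmxA -mulmxA !mulmx_base.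
rewrite -[X in map_mx polyC X](mulmx_base P) map_mxM scalemxAl det_addmulC.
rewrite -scalemxAr -map_mxM RC map_mx1 -[1%:M in X in X + _]scale1r -scalerDl.
by rewrite addrC subrK detZ det1 mulr1.
Qed.

(** A root of the product at 0 is a root of one of the factors, so the powers of ['X] are stripped
    off one at a time. *)
Lemma poly_monomial_factor (R : idomainType) (c : R) (k : nat) (p q : {poly R}) :
  c != 0 -> p * q = c%:P * 'X^k -> exists (a : R) (d : nat), p = a%:P * 'X^d.
Proof.
move=> c0; elim: k p q => [|k IH] p q e.
  have : size (p * q) = 1%N by rewrite e expr0 mulr1 size_polyC c0.
  move/eqP; rewrite size_mul_eq1 => /andP[/size_poly1P[a a0 ->] _].
  by exists a, 0%N; rewrite expr0 mulr1.
have : root (p * q) 0 by rewrite e rootE !hornerE expr0n mulr0.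
have X0 : ('X : {poly R}) != 0 by rewrite polyX_eq0.
rewrite rootM => /orP[] /factor_theorem [p']; rewrite subr0 => ep.
  have [|a [d ed]] := IH p' q.
    by apply: (mulIf X0); rewrite -[RHS]mulrA -exprSr -e ep mulrAC.
  by exists a, d.+1; rewrite ep ed exprSr mulrA.
apply: (IH p p'); apply: (mulIf X0).
by rewrite -[RHS]mulrA -exprSr -e ep mulrA.
Qed.

(* [P M0 = 0] gives [M0 + s M1 = (1 + (s - 1) P) N(s)] with
   [N(s) = P M1 + M0 + s (1 - P) M1]. *)
Lemma det_pencil (F : fieldType) (k : nat) (P M0 M1 : 'M[F]_k) :
    P *m P = P -> P *m M0 = 0 ->
  exists2 q : {poly F},
    \det (map_mx polyC M0 + 'X *: map_mx polyC M1) = 'X^(\rank P) * q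
    & q.[0] = \det (P *m M1 + M0).
Proof.
move=> PP PM0.
pose N := map_mx polyC (P *m M1 + M0) + 'X *: map_mx polyC (M1 - P *m M1).
exists (\det N); last first.
  rewrite -[LHS]/(horner_eval 0 _) -det_map_mx; congr (\det _).
  by apply/matrixP=> i j; rewrite !mxE /= /horner_eval !hornerE.
rewrite -det_scale_idempotent // -det_mulmx; congr (\det _).
set f := map_mx polyC.
have eN : f P *m N = f (P *m M1).
  rewrite /N mulmxDr -scalemxAr -/f -!map_mxM mulmxDr mulmxBr !mulmxA PP PM0.
  by rewrite addr0 subrr map_mx0 scaler0 addr0.
rewrite mulmxDl mul1mx -scalemxAl eN /N /f; move: (P *m M1) => K.
by apply/matrixP=> i j; rewrite !mxE; ring.
Qed.

(** * Joint characteristic polynomials on lines and axes *)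

Lemma mpoly_rmorph_ext (R : nzRingType) (S : nzRingType) (n : nat)
    (g h : {rmorphism {mpoly R[n]} -> S}) :
    (forall c, g c%:MP = h c%:MP) -> (forall i, g 'X_i = h 'X_i) -> g =1 h.
Proof.
move=> ghC ghX p; rewrite [p]mpolyE !rmorph_sum; apply: eq_bigr => m _.
rewrite -mul_mpolyC !rmorphM /= ghC; congr (_ * _).
rewrite mpolyXE_id !rmorph_prod; apply: eq_bigr => i _.
by rewrite !rmorphXn /= ghX.
Qed.

(** Evaluation, restriction to a line and radial scaling are ring morphisms; all of them are
    computed on the joint characteristic polynomial through this identity. *)
Lemma joint_charpoly_rmorph (C : numClosedFieldType) (k N : nat)
    (B : N.-tuple 'M[C]_k) (S : comNzRingType)
    (g : {rmorphism {mpoly C[N.+1]} -> S}) :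
  g (joint_charpoly B) =
  \det (g 'X_ord0 *: 1%:M
        + \sum_(i < N) g 'X_(lift ord0 i) *: map_mx (g \o @mpolyC _ C) (tnth B i)).
Proof.
rewrite /joint_charpoly -det_map_mx map_mxD map_mxZ map_mx1 raddf_sum.
by congr (\det (_ + _)); apply: eq_bigr => i _; rewrite /= map_mxZ -map_mx_comp.
Qed.

Definition affine_point (C : nzRingType) (N : nat) (z0 : C) (z : 'I_N -> C) :
    'I_N.+1 -> C :=
  fun j => if unlift ord0 j is Some j' then z j' else z0.

Lemma meval_joint_charpoly (C : numClosedFieldType) (k N : nat)
    (B : N.-tuple 'M[C]_k) (z0 : C) (z : 'I_N -> C) :
  (joint_charpoly B).@[affine_point z0 z]
    = \det (z0 *: 1%:M + \sum_(i < N) z i *: tnth B i).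
Proof.
rewrite joint_charpoly_rmorph /= mevalXU /affine_point unlift_none.
congr (\det (_ + _)); apply: eq_bigr => i _; rewrite mevalXU liftK.
by congr (_ *: _); apply/matrixP=> a b; rewrite !mxE /= mevalC.
Qed.

Lemma meval_dehom (C : numClosedFieldType) (N : nat) (p : {mpoly C[N.+1]})
    (z : 'I_N -> C) :
  (dehom p).@[z] = p.@[affine_point (-1) z].
Proof.
rewrite /dehom comp_mpoly_meval; apply: meval_eq => j.
rewrite tnth_mktuple /affine_point; case: unlift => [j'|]; first exact: mevalXU.
by rewrite mevalN meval1.
Qed.

Lemma sum_axis_point (C : numClosedFieldType) (N : nat) (V : lmodType C)
    (i : 'I_N) (c : C) (v : 'I_N -> V) :
  \sum_(j < N) axis_point i c j *: v j = c *: v i.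
Proof.
rewrite (bigD1 i) //= big1 ?addr0 => [|j /negPf ji]; rewrite /axis_point ?eqxx //.
by rewrite ji scale0r.
Qed.

(** The restriction of [p] to the line s -> x + s d, kept as a polynomial so that orders of
    vanishing in s can be compared. *)
Definition on_line (C : comNzRingType) (n : nat) (x d : 'I_n -> C)
    (p : {mpoly C[n]}) : {poly C} :=
  mmap (@polyC C) (fun i => (x i)%:P + (d i)%:P * 'X) p.

HB.instance Definition _ (C : comNzRingType) (n : nat) (x d : 'I_n -> C) :=
  GRing.RMorphism.copy (on_line x d)
    (mmap (@polyC C) (fun i => (x i)%:P + (d i)%:P * 'X)).

Lemma on_lineC (C : comNzRingType) (n : nat) (x d : 'I_n -> C) (c : C) :
  on_line x d c%:MP = c%:P.
Proof. exact: mmapC. Qed.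

Lemma on_lineX (C : comNzRingType) (n : nat) (x d : 'I_n -> C) (i : 'I_n) :
  on_line x d 'X_i = (x i)%:P + (d i)%:P * 'X.
Proof. by rewrite /on_line mmapX mmap1U. Qed.

Lemma horner_on_line (C : comNzRingType) (n : nat) (x d : 'I_n -> C)
    (p : {mpoly C[n]}) (s : C) :
  (on_line x d p).[s] = p.@[fun i => x i + d i * s].
Proof.
pose g : {rmorphism {mpoly C[n]} -> C} := horner_eval s \o on_line x d.
pose h : {rmorphism {mpoly C[n]} -> C} := meval (fun i => x i + d i * s).
apply: (@mpoly_rmorph_ext _ _ _ g h) => [c|i] /=; rewrite /horner_eval.
  by rewrite on_lineC hornerC mevalC.
by rewrite on_lineX mevalXU !hornerE.
Qed.

(** Chain rule: the identity holds for constants and variables and passes to sums and products. *)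
Lemma deriv_on_line0 (C : comNzRingType) (n : nat) (x d : 'I_n -> C)
    (p : {mpoly C[n]}) :
  ((on_line x d p)^`()).[0] = \sum_(i < n) d i * (p^`M(i)).@[x].
Proof.
have at0 q : (on_line x d q).[0] = q.@[x].
  by rewrite horner_on_line; apply: meval_eq => i; rewrite mulr0 addr0.
pose P (q : {mpoly C[n]}) :=
  ((on_line x d q)^`()).[0] = \sum_(i < n) d i * (q^`M(i)).@[x].
have PC c : P c%:MP.
  rewrite /P on_lineC derivC horner0 big1 // => i _.
  by rewrite mderivC meval0 mulr0.
have PM q1 q2 : P q1 -> P q2 -> P (q1 * q2).
  rewrite /P => e1 e2; rewrite rmorphM derivM !hornerE !at0 e1 e2.
  rewrite mulr_suml mulr_sumr -big_split /=; apply: eq_bigr => i _.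
  by rewrite mderivM mevalD !mevalM; ring.
have PX i : P 'X_i.
  rewrite /P on_lineX !derivE !hornerE (bigD1 i) //= big1 => [|j ji].
    have -> : ('X_i)^`M(i) = 1 :> {mpoly C[n]}.
      rewrite mderivX mnm1E eqxx scale1r -mpolyX0; congr mpolyX.
      by apply/mnmP => j; rewrite mnmBE mnm0E subnn.
    by rewrite meval1 mulr1 addr0.
  by rewrite mderivX mnm1E eq_sym (negPf ji) scale0r meval0 mulr0.
have PD q1 q2 : P q1 -> P q2 -> P (q1 + q2).
  rewrite /P => e1 e2; rewrite rmorphD derivD !hornerE e1 e2 -big_split /=.
  by apply: eq_bigr => i _; rewrite mderivD mevalD mulrDr.
rewrite -/(P p) [p]mpolyE; apply: (big_ind P) => [|q1 q2|m _]; [|exact: PD|].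
  by rewrite -mpolyC0; apply: PC.
rewrite -mul_mpolyC; apply: (PM _ _ (PC _)).
rewrite mpolyXE_id; apply: (big_ind P) => [|q1 q2|i _]; [|exact: PM|].
  by rewrite -mpolyC1; apply: PC.
elim: (m i) => [|e IH]; first by rewrite expr0 -mpolyC1; apply: PC.
by rewrite exprS; apply: PM.
Qed.

(** This is p(s X) for a new variable s; homogeneity of degree d becomes
    [radial p = p%:P * 'X^d]. *)
Definition radial (C : comNzRingType) (n : nat) (p : {mpoly C[n]}) :
    {poly {mpoly C[n]}} :=
  mmap (@polyC _ \o @mpolyC n C) (fun i => ('X_i)%:P * 'X) p.

HB.instance Definition _ (C : comNzRingType) (n : nat) :=
  GRing.RMorphism.copy (@radial C n)
    (mmap (@polyC _ \o @mpolyC n C) (fun i => ('X_i)%:P * 'X)).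

Lemma radialC (C : comNzRingType) (n : nat) (c : C) :
  @radial C n c%:MP = c%:MP%:P.
Proof. exact: mmapC. Qed.

Lemma radialX (C : comNzRingType) (n : nat) (i : 'I_n) :
  @radial C n 'X_i = ('X_i)%:P * 'X.
Proof. by rewrite /radial mmapX mmap1U. Qed.

Lemma horner_radial (C : comNzRingType) (n : nat) (p : {mpoly C[n]}) (z : 'I_n -> C)
    (s : C) :
  (map_poly (meval z) (radial p)).[s] = p.@[fun i => z i * s].
Proof.
pose g : {rmorphism {mpoly C[n]} -> C} := horner_eval s \o map_poly (meval z) \o @radial C n.
pose h : {rmorphism {mpoly C[n]} -> C} := meval (fun i => z i * s).
apply: (@mpoly_rmorph_ext _ _ _ g h) => [c|i] /=; rewrite /horner_eval.
  by rewrite radialC map_polyC hornerC /= !mevalC.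
by rewrite radialX rmorphM /= map_polyC map_polyX !hornerE /= !mevalXU.
Qed.

Lemma horner_radial1 (C : comNzRingType) (n : nat) (p : {mpoly C[n]}) :
  (radial p).[1] = p.
Proof.
pose g : {rmorphism {mpoly C[n]} -> {mpoly C[n]}} := horner_eval 1 \o @radial C n.
apply: (@mpoly_rmorph_ext _ _ _ g idfun) => [c|i] /=; rewrite /horner_eval.
  by rewrite radialC hornerC.
by rewrite radialX !hornerE.
Qed.

Lemma horner_radial0 (C : comNzRingType) (n : nat) (p : {mpoly C[n]}) :
  (radial p).[0] = (p.@[fun=> 0])%:MP.
Proof.
pose g : {rmorphism {mpoly C[n]} -> {mpoly C[n]}} := horner_eval 0 \o @radial C n.
pose h : {rmorphism {mpoly C[n]} -> {mpoly C[n]}} := @mpolyC n C \o meval (fun=> 0).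
apply: (@mpoly_rmorph_ext _ _ _ g h) => [c|i] /=; rewrite /horner_eval.
  by rewrite radialC hornerC mevalC.
by rewrite radialX !hornerE mevalXU mpolyC0.
Qed.

Lemma radial_joint_charpoly (C : numClosedFieldType) (k N : nat)
    (B : N.-tuple 'M[C]_k) :
  radial (joint_charpoly B) = (joint_charpoly B)%:P * 'X^k.
Proof.
pose g : {rmorphism {mpoly C[N.+1]} -> {poly {mpoly C[N.+1]}}} := polyC \o idfun.
rewrite [RHS]mulrC -[(joint_charpoly B)%:P]/(g _).
rewrite (joint_charpoly_rmorph B g) joint_charpoly_rmorph -detZ.
congr (\det _); rewrite /= radialX scalerDr scalerA scaler_sumr ['X * _]mulrC.
congr (_ + _); apply: eq_bigr => i _; rewrite radialX scalerA ['X * _]mulrC.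
by congr (_ *: _); apply/matrixP=> a b; rewrite !mxE /= radialC.
Qed.

Lemma joint_charpoly_neq0 (C : numClosedFieldType) (k N : nat)
    (B : N.-tuple 'M[C]_k) : joint_charpoly B != 0.
Proof.
apply/eqP => /(congr1 (meval (affine_point 1 (fun=> 0)))).
rewrite meval_joint_charpoly meval0 big1 => [|i _]; last exact: scale0r.
by rewrite scale1r addr0 det1 => /eqP; rewrite oner_eq0.
Qed.

(* Substituting ['X_i * s] for ['X_i] multiplies the joint characteristic
   polynomial by [s ^ k], and a factor of a monomial in [s] is a monomial. *)
Lemma radial_charpoly_factor (C : numClosedFieldType) (k N : nat)
    (B : N.-tuple 'M[C]_k) (p q : {mpoly C[N.+1]}) :
  joint_charpoly B = p * q -> exists d, radial p = p%:P * 'X^d.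
Proof.
move=> Bpq; have := radial_joint_charpoly B; rewrite {1}Bpq rmorphM /=.
case/(poly_monomial_factor (joint_charpoly_neq0 B)) => a [d e]; exists d.
have {}e : radial p = a%:P * 'X^d := e.
(* Putting s = 1 identifies the coefficient [a] with [p]. *)
by have := horner_radial1 p; rewrite {1}e hornerCM hornerXn expr1n mulr1 => ap; rewrite -{2}ap.
Qed.

(** If [p] were nonzero, [p * 'X + 1] would be nonconstant and have a root, yet its value is 1 at 0
    and, by hypothesis, everywhere else. *)
Lemma poly_eq0_of_horner (C : closedFieldType) (p : {poly C}) :
  (forall x, x != 0 -> p.[x] = 0) -> p = 0.
Proof.
move=> p0; apply/eqP; rewrite -size_poly_eq0.
have [//|/negPf sp] := boolP (size p == 0%N).
have /closed_rootP[x] : size (p * 'X + 1%:P) != 1%N.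
  by rewrite size_MXaddC -size_poly_eq0 sp eqSS sp.
rewrite rootE !hornerE; have [->|/p0->] := eqVneq x 0.
  by rewrite mulr0 add0r oner_eq0.
by rewrite mul0r add0r oner_eq0.
Qed.

(** If p(-1, c e_i) vanished for no c, it would be a constant; by homogeneity p(-x, e_i) would then
    be a multiple of x^d with d positive, and its zero at x = 0 would make [tnth B i] singular. *)
Lemma component_meets_axis (C : numClosedFieldType) (k N : nat)
    (B : N.-tuple 'M[C]_k) (p q : {mpoly C[N.+1]}) (i : 'I_N) :
    tnth B i \in unitmx -> mirreducible p -> joint_charpoly B = p * q ->
  exists c : C, component p (axis_point i c).
Proof.
move=> Bi [p0 pU _] Bpq; have [d pd] := radial_charpoly_factor Bpq.
have p_hom z s : p.@[fun j => z j * s] = p.@[z] * s ^+ d.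
  by rewrite -horner_radial pd rmorphM /= map_polyC map_polyXn !hornerE.
(* In degree 0, [p] would equal its value at the origin and be a unit. *)
have d_gt0 : (0 < d)%N.
  rewrite lt0n; apply: contraNneq pU => d0.
  have := horner_radial0 p; rewrite pd d0 expr0 mulr1 hornerC => e.
  rewrite e in p0 *; apply: rmorph_unit; rewrite unitfE.
  by apply: contraNneq p0 => ->; rewrite mpolyC0.
pose h := on_line (affine_point (-1) (fun=> 0)) (affine_point 0 (axis_point i 1)) p.
have [/closed_rootP[c hc]|] := boolP (size h != 1%N).
  exists c; rewrite /component meval_dehom; move: hc; rewrite /root horner_on_line.
  move/eqP=> <-; apply: meval_eq => j; rewrite /affine_point /axis_point.
  by case: unlift => [j'|]; rewrite ?mul0r ?addr0 // add0r; case: eqP; rewrite ?mul1r ?mul0r.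
rewrite negbK => /size_poly1P [h0 _ eh].
(* This is p(-x, e_i), which equals x^d h(1/x) away from x = 0. *)
pose g := on_line (affine_point 0 (axis_point i 1)) (affine_point (-1) (fun=> 0)) p.
have g0 : g = h0%:P * 'X^d.
  apply/eqP; rewrite -subr_eq0; apply/eqP/poly_eq0_of_horner => x x0.
  apply/eqP; rewrite !hornerE subr_eq0 horner_on_line; apply/eqP.
  have -> : h0 = h.[x^-1] by rewrite eh hornerC.
  rewrite horner_on_line -p_hom; apply: meval_eq => j; rewrite /affine_point.
  case: unlift => [j'|]; rewrite ?mul0r ?addr0 ?add0r //.
  by rewrite mulfVK // mul0r addr0.
have : (joint_charpoly B).@[affine_point 0 (axis_point i 1)] = 0.
  rewrite Bpq mevalM (_ : p.@[_] = 0) ?mul0r //.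
  have : g.[0] = 0 by rewrite g0 !hornerE expr0n gtn_eqF // mulr0.
  by rewrite horner_on_line => g00; rewrite -[RHS]g00; apply: meval_eq => j; rewrite mulr0 addr0.
rewrite meval_joint_charpoly scale0r add0r sum_axis_point scale1r.
by move/eqP; rewrite -[_ == 0]negbK -unitfE -unitmxE Bi.
Qed.

(** * Spectral projections *)

Lemma herm_adjoint (C : numClosedFieldType) (k : nat) (M : 'M[C]_k) :
  M \is hermsymmx -> M^t* = M.
Proof. by move/is_hermitianmxP; rewrite expr0 scale1r => /esym. Qed.

Lemma adjointM (C : numClosedFieldType) (m n p : nat) (M : 'M[C]_(m, n))
    (N : 'M[C]_(n, p)) : (M *m N)^t* = N^t* *m M^t*.
Proof. by rewrite trmx_mul map_mxM. Qed.

(** Let Q be the projection. The rows of 1 - Q are orthogonal to those of Q, so the adjoint of Q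
    equals Q times its adjoint, which is self-adjoint. *)
Lemma proj_ortho_adjoint (C : numClosedFieldType) (p k : nat) (U : 'M[C]_(p, k)) :
  (proj_ortho U)^t* = proj_ortho U.
Proof.
have /orthomx1P : (1%:M - 1%:M *m proj_ortho U <=
    orthomx Num.conj (mx_of_hermitian (hermitian1mx _)) (proj_ortho U))%MS.
  by rewrite (eqmx_ortho _ (proj_orthoE U)) proj_ortho_compl_sub.
rewrite mul1mx mulmxBl mul1mx => /eqP; rewrite subr_eq0 => /eqP e.
rewrite e; have := congr1 (fun N : 'M[C]_k => N^t*) e.
by rewrite trmxCK (adjointM (proj_ortho U)) trmxCK => /esym.
Qed.

Lemma col_mulmx (R : nzRingType) (m n p : nat) (A : 'M[R]_(m, n))
    (B : 'M[R]_(n, p)) (j : 'I_p) : col j (A *m B) = A *m col j B.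
Proof. by rewrite !colE mulmxA. Qed.

Lemma eq_mulmx_cols (R : nzRingType) (m n p : nat) (A A' : 'M[R]_(m, n))
    (V : 'M[R]_(n, p)) :
  (forall j, A *m col j V = A' *m col j V) -> A *m V = A' *m V.
Proof.
move=> e; apply/matrixP => i j.
have /colP/(_ i) : col j (A *m V) = col j (A' *m V) by rewrite !col_mulmx.
by rewrite !mxE.
Qed.

Lemma normal_eigenbasis (C : numClosedFieldType) (k : nat) (M : 'M[C]_k) :
    M \is normalmx ->
  exists2 V : 'M[C]_k, V \in unitmx
    & forall i, exists2 c, col i V != 0 & M *m col i V = c *: col i V.
Proof.
move/orthomx_spectralP; set U := spectralmx M; set D := spectral_diag M => eM.
have Uu : U \in unitmx := spectral_unit M.
exists (invmx U) => [|i]; first by rewrite unitmx_inv.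
exists (D 0 i).
  apply/eqP => c0; have /(congr1 (col i)) : U *m invmx U = 1%:M by rewrite mulmxV.
  rewrite col_mulmx c0 mulmx0 => /colP/(_ i)/eqP.
  by rewrite !mxE eqxx eq_sym oner_eq0.
rewrite -col_mulmx {1}eM mulmxK //; apply/colP=> j.
by rewrite mul_mx_diag !mxE mulrC.
Qed.

(** Normality gives a basis of eigenvectors and so excludes nonzero nilpotent matrices. *)
Lemma normal_eq0 (C : numClosedFieldType) (k : nat) (M : 'M[C]_k) :
    M \is normalmx ->
    (forall c (y : 'cV_k), y != 0 -> M *m y = c *: y -> c = 0) ->
  M = 0.
Proof.
move=> /normal_eigenbasis[V Vu Vcol] M_nil.
rewrite -[M](mulmxK Vu) (@eq_mulmx_cols _ _ _ _ M 0) => [|i]; first by rewrite !mul0mx.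
have [c v0 e] := Vcol i.
by rewrite mul0mx e (M_nil c _ v0 e) scale0r.
Qed.

Section EigenProjection.
Variables (C : numClosedFieldType) (k : nat) (M : 'M[C]_k).
Hypothesis M_herm : M \is hermsymmx.
Let Madj : M^t* = M := herm_adjoint M_herm.

Lemma eigenproj_idem (a : C) : eigenproj M a *m eigenproj M a = eigenproj M a.
Proof. by rewrite /eigenproj -trmx_mul proj_ortho_proj. Qed.

Lemma eigenproj_adjoint (a : C) : (eigenproj M a)^t* = eigenproj M a.
Proof.
by rewrite /eigenproj -[in RHS]proj_ortho_adjoint map_trmx !trmxK.
Qed.

Lemma mul_eigenproj (a : C) : M *m eigenproj M a = a *: eigenproj M a.
Proof.
have /eigenspaceP : (proj_ortho (eigenspace M^T a) <= eigenspace M^T a)%MS.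
  by rewrite proj_orthoE.
by move/(congr1 trmx); rewrite trmx_mul trmxK linearZ.
Qed.

(** Taking adjoints in [mul_eigenproj] yields the factor [a^*]; computing P M P in two ways turns it
    into [a], even when P = 0. *)
Lemma eigenproj_mul (a : C) : eigenproj M a *m M = a *: eigenproj M a.
Proof.
have e : eigenproj M a *m M = a^* *: eigenproj M a.
  have := congr1 (fun N => N^t*) (mul_eigenproj a).
  by rewrite adjointM Madj eigenproj_adjoint linearZ /= map_mxZ eigenproj_adjoint.
have := congr1 (mulmx^~ (eigenproj M a)) e.
rewrite -mulmxA mul_eigenproj -scalemxAr -scalemxAl eigenproj_idem => e2.
by rewrite e -e2.
Qed.

Lemma eigenproj_id (a : C) (m : nat) (y : 'M[C]_(k, m)) :
  M *m y = a *: y -> eigenproj M a *m y = y.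
Proof.
move=> /(congr1 trmx); rewrite trmx_mul linearZ /= => /eigenspaceP ye.
by apply: trmx_inj; rewrite trmx_mul trmxK proj_ortho_id.
Qed.

Lemma eigenproj_ortho (a b : C) : a != b -> eigenproj M a *m eigenproj M b = 0.
Proof.
move=> ab; have := mulmxA (eigenproj M a) M (eigenproj M b).
rewrite eigenproj_mul mul_eigenproj -scalemxAl -scalemxAr => /esym/eqP.
by rewrite -subr_eq0 -scalerBl scaler_eq0 subr_eq0 (negPf ab) => /eqP.
Qed.

Lemma eigenproj_eigenvalue (a : C) : eigenproj M a != 0 -> eigenvalue M a.
Proof.
move=> P0; apply/eigenvalueP; have [i Pi0] : exists i, row i (eigenproj M a) != 0.
  apply/existsP; apply: contraNT P0; rewrite negb_exists => /forallP Pi.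
  by apply/eqP/row_matrixP=> i; rewrite row0; apply/eqP; rewrite -[_ == _]negbK Pi.
by exists (row i (eigenproj M a)) => //; rewrite -row_mul eigenproj_mul linearZ.
Qed.

(** Both sides are tested on an eigenbasis: each vector is fixed by the projection of its own
    eigenvalue and killed by the others. *)
Lemma sum_eigenproj (r : nat) (lam : r.-tuple C) :
  distinct_eigenvalues M lam -> \sum_(j < r) eigenproj M (tnth lam j) = 1%:M.
Proof.
move=> [lam_uniq lamP]; have [V Vu Vcol] := normal_eigenbasis (hermitian_normalmx M_herm).
apply: (can_inj (mulmxK Vu)); apply: eq_mulmx_cols => i; rewrite mul1mx.
have [c v0 e] := Vcol i; have Pv := eigenproj_id e.
have /tnthP[j cj] : c \in lam.
  rewrite lamP; apply: eigenproj_eigenvalue.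
  by apply: contraNneq v0 => P0; rewrite -Pv P0 mul0mx.
rewrite mulmx_suml (bigD1 j) //= big1 => [|j' j'j]; first by rewrite -cj addr0.
rewrite -Pv mulmxA eigenproj_ortho ?mul0mx // cj.
by rewrite (inj_eq (tuple_uniqP _ lam_uniq)).
Qed.

End EigenProjection.

(** * First-order behaviour at a stable axis point *)

Lemma det0_colP (F : fieldType) (k : nat) (A : 'M[F]_k) :
  reflect (exists2 y : 'cV_k, y != 0 & A *m y = 0) (\det A == 0).
Proof.
rewrite -det_tr; apply: (iffP det0P) => -[v v0 e].
  exists v^T; first by rewrite -trmx0 (inj_eq trmx_inj).
  by apply: trmx_inj; rewrite trmx_mul trmxK trmx0.
exists v^T; first by rewrite -trmx0 (inj_eq trmx_inj).
by rewrite -trmx_mul e trmx0.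
Qed.

Lemma mulXn_valuation (R : idomainType) (m n : nat) (p q : {poly R}) :
  p.[0] != 0 -> q.[0] != 0 -> 'X^m * p = 'X^n * q -> m = n.
Proof.
have aux a b (f g : {poly R}) : f.[0] != 0 -> 'X^a * f = 'X^b * g -> (b <= a)%N.
  move=> f0 e; rewrite leqNgt; apply: contraNN f0 => ab.
  have : f = 'X^(b - a) * g.
    apply: (@mulfI _ 'X^a); first by rewrite expf_neq0 ?polyX_eq0.
    by rewrite e mulrA -exprD subnKC // ltnW.
  by move=> ->; rewrite hornerM hornerXn expr0n subn_eq0 leqNgt ab mul0r.
move=> p0 q0 e; apply/eqP; rewrite eqn_leq (aux n m q p) //=.
by rewrite (aux m n p q).
Qed.

(** Brings the restriction to a line into the pencil shape of [det_pencil]. *)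
Lemma on_line_dehom_charpoly (C : numClosedFieldType) (k N : nat)
    (B : N.-tuple 'M[C]_k) (x d : 'I_N -> C) :
  on_line x d (dehom (joint_charpoly B)) =
  \det (map_mx polyC (\sum_(i < N) x i *: tnth B i - 1%:M)
        + 'X *: map_mx polyC (\sum_(i < N) d i *: tnth B i)).
Proof.
pose v : N.+1.-tuple {mpoly C[N]} :=
  [tuple if unlift ord0 i is Some j then 'X_j else -1 | i < N.+1].
pose g : {rmorphism {mpoly C[N.+1]} -> {poly C}} := on_line x d \o comp_mpoly v.
rewrite -[LHS]/(g (joint_charpoly B)) joint_charpoly_rmorph /g /=.
have vE i : 'X_i \mPo v = tnth v i by rewrite comp_mpolyXU -tnth_nth.
rewrite vE tnth_mktuple unlift_none rmorphN rmorph1 scaleN1r addrC.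
congr (\det _); rewrite map_mxB map_mx1 -addrA [X in _ = _ + X]addrC addrA.
congr (_ - _); rewrite !raddf_sum -big_split /=.
apply: eq_bigr => i _; rewrite vE tnth_mktuple liftK on_lineX !map_mxZ.
rewrite scalerA ['X * _]mulrC -scalerDl; congr (_ *: _).
by apply/matrixP => r s; rewrite !mxE /= comp_mpolyC on_lineC.
Qed.

Section StableAxisPoint.
Variables (C : numClosedFieldType) (k N m : nat) (B : N.-tuple 'M[C]_k).
Variables (F : 'I_m -> {mpoly C[N.+1]}) (t : 'I_m -> nat).
Hypothesis BF : joint_charpoly B = \prod_(j < m) F j ^+ t j.
Variables (i0 : 'I_N) (lam : C) (j : 'I_m).
Hypothesis lam0 : lam != 0.
Let tau := axis_point i0 lam^-1.
Hypothesis Fj : component (F j) tau.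
Hypothesis Fj_uniq : forall l, component (F l) tau -> l = j.
Hypothesis Fj_simple : ((dehom (F j))^`M(i0)).@[tau] != 0.
Variable P : 'M[C]_k.
Hypothesis P_idem : P *m P = P.
Hypothesis mulBP : tnth B i0 *m P = lam *: P.
Hypothesis mulPB : P *m tnth B i0 = lam *: P.
Hypothesis P_id : forall y : 'cV_k, tnth B i0 *m y = lam *: y -> P *m y = y.

(** [M0] is the matrix of the pencil at [tau], and its kernel is the range of [P]; [gradient w] is
    the derivative of the dehomogenised [F j] at [tau] along [w]. *)
Let M0 : 'M[C]_k := lam^-1 *: tnth B i0 - 1%:M.
Let gradient (w : 'I_N -> C) := \sum_(i < N) w i * ((dehom (F j))^`M(i)).@[tau].
Let direction (w : 'I_N -> C) := \sum_(i < N) w i *: tnth B i.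

Let PM0 : P *m M0 = 0.
Proof. by rewrite mulmxBr mulmx1 -scalemxAr mulPB scalerA mulVf // scale1r subrr. Qed.

Let M0P : M0 *m P = 0.
Proof. by rewrite mulmxBl mul1mx -scalemxAl mulBP scalerA mulVf // scale1r subrr. Qed.

Let kerM0 (y : 'cV_k) : M0 *m y = 0 -> P *m y = y.
Proof.
rewrite mulmxBl mul1mx -scalemxAl => /eqP; rewrite subr_eq0 => /eqP e.
by apply: P_id; rewrite -[in RHS]e scalerA mulfV // scale1r.
Qed.

(** The restriction to tau + s w is expanded twice: by the factorization, where only [F j] vanishes
    at s = 0, and by [det_pencil]. *)
Let line_expansion (w : 'I_N -> C) : exists g q : {poly C},
  [/\ 'X^(t j) * g = 'X^(\rank P) * q,
      exists2 g0, g0 != 0 & g.[0] = gradient w ^+ t j * g0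
    & q.[0] = \det (P *m direction w + M0)].
Proof.
have [q eq q0] := det_pencil (direction w) P_idem PM0.
have : root (on_line tau w (dehom (F j))) 0.
  rewrite rootE horner_on_line -[X in _ == X]Fj; apply/eqP/meval_eq => i.
  by rewrite mulr0 addr0.
case/factor_theorem => f; rewrite subr0 => ef.
pose G := \prod_(l < m | l != j) on_line tau w (dehom (F l)) ^+ t l.
exists (f ^+ t j * G), q; split => //.
- rewrite -eq mulrA -exprMn ['X * f]mulrC -ef.
  have -> : M0 = \sum_(i < N) tau i *: tnth B i - 1%:M by rewrite sum_axis_point.
  rewrite -on_line_dehom_charpoly BF /G.
  rewrite [RHS](_ : _ = \prod_(l < m) on_line tau w (dehom (F l)) ^+ t l); last first.
    by rewrite /dehom !rmorph_prod; apply: eq_bigr => l _; rewrite !rmorphXn.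
  by rewrite [RHS](bigD1 j).
- exists G.[0].
    rewrite horner_prod; apply/prodf_neq0 => l lj.
    rewrite horner_exp expf_neq0 //; apply: contraNneq lj => e.
    apply/eqP/Fj_uniq; rewrite /component -[RHS]e horner_on_line; apply: meval_eq => i.
    by rewrite mulr0 addr0.
  rewrite hornerM horner_exp; congr (_ ^+ _ * _).
  (* The restriction of [F j] is [f * 'X], so its derivative at 0 is [f.[0]]. *)
  have := deriv_on_line0 tau w (dehom (F j)); rewrite ef derivM derivX !hornerE.
  by [].
Qed.

(** Along the axis itself both cofactors are nonzero at s = 0: one by simplicity, the other because
    [lam *: P + M0] is injective. The two orders of vanishing therefore agree. *)
Lemma multiplicity_eq_rank : t j = \rank P.
Proof.
have [g [q [e [g0 g00 eg] eq]]] := line_expansion (axis_point i0 1).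
apply: mulXn_valuation e.
  rewrite eg mulf_neq0 // expf_neq0 // /gradient.
  by rewrite (sum_axis_point (V := C^o)) [_ *: _]mul1r.
rewrite eq /direction sum_axis_point scale1r mulPB; apply/negP => /det0_colP[y y0].
move=> Ky; have := congr1 (mulmx P) Ky.
rewrite mulmxDl mulmxDr !mulmxA PM0 mul0mx addr0 -scalemxAr P_idem mulmx0.
rewrite -scalemxAl => /eqP; rewrite scaler_eq0 (negPf lam0) => /eqP Py.
move: Ky; rewrite mulmxDl -scalemxAl Py scaler0 add0r => /kerM0.
by rewrite Py => /esym/eqP; rewrite (negPf y0).
Qed.

(** The equal powers of s in [line_expansion] cancel, and the cofactors are compared at s = 0. *)
Lemma det_eq_gradient (w : 'I_N -> C) : exists2 g0 : C, g0 != 0 &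
  \det (P *m direction w + M0) = gradient w ^+ t j * g0.
Proof.
have [g [q [e [g0 g00 eg] eq]]] := line_expansion w.
exists g0 => //; rewrite -eq -eg; congr (_.[0]); apply/esym.
apply: (@mulfI _ 'X^(t j)); first by rewrite expf_neq0 ?polyX_eq0.
by rewrite e multiplicity_eq_rank.
Qed.

(* If [P W P] has eigenvalue [nu] on the range of [P], then [det_eq_gradient]
   at the direction [(- nu / lam) B_i0 + W] has a vanishing left side; so [nu]
   solves a linear equation in which its coefficient is nonzero by simplicity. *)
Lemma normal_compression_scalar (w : 'I_N -> C) :
    P^t* = P -> P *m direction w *m P \is normalmx -> (0 < t j)%N ->
  exists c : C, P *m direction w *m P = c *: P.
Proof.
move=> Padj /normalmxP Xn t_gt0; set X := P *m _ *m P in Xn *.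
pose a := ((dehom (F j))^`M(i0)).@[tau]; pose mu := lam * gradient w / a.
have XP : X *m P = X by rewrite /X -mulmxA P_idem.
have PX : P *m X = X by rewrite /X !mulmxA P_idem.
have XaP : X^t* *m P = X^t* by rewrite -{1}Padj -adjointM PX.
have PXa : P *m X^t* = X^t* by rewrite -{1}Padj -adjointM XP.
pose G := X - mu *: P.
have Ga : G^t* = X^t* - mu^* *: P.
  by rewrite -[in RHS]Padj; apply/matrixP=> r s; rewrite !mxE rmorphB rmorphM.
have mu_uniq (nu : C) (y : 'cV_k) :
    y != 0 -> P *m y = y -> X *m y = nu *: y -> nu = mu.
  move=> y0 Py Xy; pose w' i := axis_point i0 (- nu / lam) i + w i.
  have [g0 g00] := det_eq_gradient w'.
  have -> : gradient w' = - nu / lam * a + gradient w.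
    rewrite /gradient; under eq_bigr do rewrite mulrDl.
    by rewrite big_split /= (sum_axis_point (V := C^o)).
  have -> : direction w' = (- nu / lam) *: tnth B i0 + direction w.
    rewrite /direction; under eq_bigr do rewrite scalerDl.
    by rewrite big_split /= sum_axis_point.
  have /eqP -> : \det (P *m ((- nu / lam) *: tnth B i0 + direction w) + M0) == 0.
    apply/det0_colP; exists y => //; rewrite mulmxDl -{2}Py mulmxA M0P mul0mx addr0.
    rewrite mulmxDr mulmxDl -scalemxAr mulPB scalerA divfK // -scalemxAl Py.
    by rewrite -{2}Py mulmxA Xy scaleNr addNr.
  move/esym/eqP; rewrite mulf_eq0 (negPf g00) orbF expf_eq0 t_gt0 /=.
  rewrite mulNr mulNr addrC subr_eq0 => /eqP e.
  by rewrite /mu e; field; rewrite lam0 Fj_simple.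
exists mu; apply/eqP; rewrite -subr_eq0; apply/eqP.
(* An eigenvector of [G] for c != 0 lies in the range of [P] and is an eigenvector of [X] for c +
   mu, against [mu_uniq]. *)
apply: normal_eq0 => [|c y y0].
  apply/normalmxP; rewrite -/G Ga !mulmxBl !mulmxBr -!scalemxAr -!scalemxAl Xn.
  rewrite XP PX XaP PXa P_idem !scalerA.
  by apply/matrixP=> r s; rewrite !mxE; ring.
rewrite -/G => Gy; have [//|c0] := eqVneq c 0.
have PG : P *m G = G by rewrite mulmxBr PX -scalemxAr P_idem.
have Py : P *m y = y.
  by rewrite -[y](scalerK c0) -Gy -scalemxAr mulmxA PG.
apply: (addIr mu); rewrite add0r; apply: (mu_uniq _ y) => //.
by rewrite scalerDl -Gy mulmxBl -scalemxAl Py subrK.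
Qed.

End StableAxisPoint.

(** * Words and invariant subspaces *)

(** [S] is a mere predicate, not a [{vspace V}]. Starting from the line of [x], images under the
    [f i] are added inside [S] until the space is stable; the codimension bounds the number of
    steps. *)
Lemma stable_subspace (K : fieldType) (V : vectType K) (n : nat)
    (f : 'I_n -> 'End(V)) (S : V -> Prop) (x : V) :
    (forall a y z, S y -> S z -> S (a *: y + z)) ->
    (forall i y, S y -> S (f i y)) -> S x ->
  exists U : {vspace V}, [/\ x \in U, forall y, y \in U -> S y
    & forall i y, y \in U -> f i y \in U].
Proof.
move=> Slin Sf Sx.
have S0 : S 0 by rewrite -(addNr x) -scaleN1r; apply: Slin.
have SD y z : S y -> S z -> S (y + z).
  by move=> Sy Sz; rewrite -[y]scale1r; apply: Slin.
suff aux d (U : {vspace V}) : (\dim {:V} - \dim U <= d)%N ->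
    x \in U -> (forall y, y \in U -> S y) ->
    exists U' : {vspace V}, [/\ x \in U', forall y, y \in U' -> S y
      & forall i y, y \in U' -> f i y \in U'].
  apply: (aux _ <[x]>%VS (leqnn _) (memv_line x)) => y /vlineP[c ->].
  by rewrite -[_ *: _]addr0; apply: Slin.
elim: d U => [|d IH] U dimU xU US; have [Uf|] := boolP [forall i, f i @: U <= U]%VS.
- exists U; split=> // i y yU; apply: (subvP (forallP Uf i)).
  exact: memv_img.
- rewrite leqn0 subn_eq0 in dimU.
  have -> : U = fullv by apply/eqP; rewrite eqEdim subvf.
  by case/forallPn => i; rewrite subvf.
- exists U; split=> // i y yU; apply: (subvP (forallP Uf i)).
  exact: memv_img.
case/forallPn => i fU; apply: (IH (U + f i @: U)%VS).
- suff ltU : (\dim U < \dim (U + f i @: U))%N.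
    rewrite leq_subLR in dimU; rewrite leq_subLR.
    by rewrite (leq_trans dimU) // addnS -addSn leq_add2r.
  rewrite ltnNge; apply: contra fU => leU.
  have /eqP eU : (U == U + f i @: U)%VS by rewrite eqEdim addvSl.
  by rewrite [X in (_ <= X)%VS]eU addvSr.
- by rewrite (subvP (addvSl _ _)).
- move=> y /memv_addP[u uU [_ /memv_imgP[w wU ->] ->]].
  by apply: SD; [exact: US | apply: Sf; apply: US].
Qed.

Lemma last_take_nth (T : Type) (x : T) (s : seq T) (a : nat) :
  (a <= size s)%N -> last x (take a s) = nth x (x :: s) a.
Proof. by elim: s a x => [|y s IH] [|a] x //= ?; rewrite IH //; apply: set_nth_default. Qed.

Section Words.
Variables (C : numClosedFieldType) (k n r : nat).
Variables (A : n.-tuple 'M[C]_k) (P : 'I_r -> 'M[C]_k).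
Hypothesis A_adj : forall i, (tnth A i)^t* = tnth A i.
Hypothesis P_adj : forall j, (P j)^t* = P j.
Hypothesis P_idem : forall j, P j *m P j = P j.
Hypothesis P_ortho : forall i j, i != j -> P i *m P j = 0.

Lemma wordmx_rcons (u : seq 'I_n) (v : seq 'I_r) (i : 'I_n) (j : 'I_r) :
  size u = (size v).+1 ->
  wordmx A P (rcons u i) (rcons v j) = wordmx A P u v *m P j *m tnth A i.
Proof.
elim: v u => [|j' v IH] [|i' u] //= [su].
  by move/size0nil: su => ->.
by rewrite IH // !mulmxA.
Qed.

(** Letters and projections are self-adjoint, so adjunction reverses words; the words of the
    extension are thus closed under adjoints. *)
Lemma wordmx_adjoint (u : seq 'I_n) (v : seq 'I_r) :
  size u = (size v).+1 -> (wordmx A P u v)^t* = wordmx A P (rev u) (rev v).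
Proof.
elim: v u => [|j v IH] [|i u] //= [su].
  by move/size0nil: su => ->; apply: A_adj.
rewrite !adjointM IH // A_adj P_adj !rev_cons wordmx_rcons ?size_rev //.
by rewrite mulmxA.
Qed.

(** A walk on the indices of the projections: it starts at [j], and each pair gives a letter and the
    next index. A projection stands at both ends, so walks concatenate. *)
Fixpoint pathmx (j : 'I_r) (p : seq ('I_n * 'I_r)) : 'M[C]_k :=
  if p is (i, j') :: p' then P j *m tnth A i *m pathmx j' p' else P j.

Lemma mul_proj_pathmx j p : P j *m pathmx j p = pathmx j p.
Proof. by case: p => [|[i j'] p] /=; rewrite ?mulmxA P_idem. Qed.

Lemma pathmx_cat j p1 p2 :
  pathmx j (p1 ++ p2) = pathmx j p1 *m pathmx (last j (unzip2 p1)) p2.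
Proof.
elim: p1 j => [|[i j'] p1 IH] j /=; first by rewrite mul_proj_pathmx.
by rewrite IH mulmxA.
Qed.

Lemma pathmx_mul_proj j p j' :
  pathmx j p *m P j' = if last j (unzip2 p) == j' then pathmx j p else 0.
Proof.
elim: p j => [|[i j1] p IH] j /=.
  by case: eqP => [->|/eqP/P_ortho].
by rewrite -mulmxA IH; case: ifP => _; rewrite ?mulmx0.
Qed.

Lemma pathmx_wordmx j (u : seq 'I_n) (v : seq 'I_r) j' :
  size u = (size v).+1 ->
  pathmx j (zip u (rcons v j')) = P j *m wordmx A P u v *m P j'.
Proof.
elim: v u j => [|j1 v IH] [|i u] //= j [su].
  by move/size0nil: su => ->.
by rewrite IH // !mulmxA.
Qed.

Definition avoids0 (p : seq ('I_n * 'I_r)) := all (fun x : 'I_n * 'I_r => 0 < x.1)%N p.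

Hypothesis word_scalar : forall (l : 'I_r) (u : seq 'I_n) (v : seq 'I_r),
  size u = (size v).+1 -> all (fun i : 'I_n => 0 < i)%N u -> uniq v ->
  (size v < r)%N -> exists c, P l *m wordmx A P u v *m P l = c *: P l.

(* A loop visiting some projection twice factors through a shorter loop, which
   is a scalar by induction; a loop without repetition is a word of the
   extension. *)
Lemma loop_scalar j p :
  avoids0 p -> last j (unzip2 p) = j -> exists c, pathmx j p = c *: P j.
Proof.
have [m] := ubnP (size p); elim: m p j => // m IH p j sp p0 lastp.
case/lastP e : (unzip2 p) lastp => [|v j']; rewrite ?last_rcons => lastp.
  have -> : p = [::] by apply/size0nil; rewrite -(size_map snd) -/(unzip2 p) e.
  by exists 1; rewrite scale1r.
subst j'; have szp : size p = (size v).+1 by rewrite -(size_map snd) -/(unzip2 p) e size_rcons.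
(* [j :: v] lists the indices visited before the final return to [j]. *)
have [/= uniq_jv|] := boolP (uniq (j :: v)).
  have [c ec] : exists c, P j *m wordmx A P (unzip1 p) v *m P j = c *: P j.
    apply: word_scalar; rewrite ?size_map //.
    - by rewrite all_map.
    - by case/andP: uniq_jv.
    - by have := max_card (mem (j :: v)); rewrite (card_uniqP _) //= card_ord.
  by exists c; rewrite -ec -pathmx_wordmx ?size_map // -e zip_unzip.
case/(uniqPn j) => a [b [ab bv nth_ab]].
have lt_bp : (b < size p)%N by rewrite szp.
have lasta d : (d < size p)%N -> last j (unzip2 (take d p)) = nth j (j :: v) d.
  move=> dp; rewrite /unzip2 map_take -/(unzip2 p) last_take_nth ?size_map ?(ltnW dp) //.
  by rewrite e -rcons_cons nth_rcons /= -szp dp.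
(* [p2] is a loop at the repeated index, and [p1 ++ p3] is the loop left after its removal; both are
   shorter than [p], since [p3] and [p2] are nonempty. *)
pose p1 := take a p; pose p2 := drop a (take b p); pose p3 := drop b p.
have ep12 : take b p = p1 ++ p2.
  by rewrite -[LHS](cat_take_drop a) take_takel // ltnW.
have ep : p = p1 ++ p2 ++ p3 by rewrite catA -ep12 cat_take_drop.
have sizes : (size p1 + (size p2 + size p3) = size p)%N by rewrite [in RHS]ep !size_cat.
have p2_gt0 : (0 < size p2)%N by rewrite size_drop size_takel ?subn_gt0 // ltnW.
have p3_gt0 : (0 < size p3)%N by rewrite size_drop subn_gt0.
set x := nth j (j :: v) a in nth_ab.
have last1 : last j (unzip2 p1) = x by rewrite lasta // (ltn_trans ab).
have last2 : last x (unzip2 p2) = x.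
  by rewrite -{1}last1 -last_cat -[_ ++ _]map_cat -ep12 [LHS]lasta.
have last3 : last x (unzip2 p3) = j.
  have : last j (unzip2 p) = j by rewrite e last_rcons.
  by rewrite ep /unzip2 !map_cat !last_cat -!/(unzip2 _) last1 last2.
move: p0; rewrite ep /avoids0 !all_cat => /and3P[p1_0 p2_0 p3_0].
have [|c ec] := IH p2 x _ p2_0 last2; first by lia.
have [|||c' ec'] := IH (p1 ++ p3) j.
- by rewrite size_cat; lia.
- by rewrite /avoids0 all_cat p1_0.
- by rewrite /unzip2 map_cat last_cat -!/(unzip2 _) last1 last3.
exists (c * c').
rewrite !pathmx_cat last1 last2 ec -scalemxAl -scalemxAr mul_proj_pathmx.
by rewrite -scalerA -ec' pathmx_cat last1.
Qed.

Hypothesis letter0_span : forall i : 'I_n, ~~ (0 < i)%N ->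
  exists a : 'I_r -> C, tnth A i = \sum_j a j *: P j.
Hypothesis P_sum : \sum_j P j = 1%:M.

(** Rather than generating the span of all w x, the proof takes the set [S] of the y that every walk
    from [l] sends into the line of [x]. It is invariant, and it contains [x] because loops are
    scalar and other walks kill [x]. *)
Lemma reducible_of_rank (l : 'I_r) : (1 < \rank (P l))%N -> reducible A.
Proof.
move=> rankP.
have [j Pj] : exists j, col j (P l) != 0.
  apply/existsP; apply: contraLR rankP; rewrite negb_exists => /forallP Pl.
  suff -> : P l = 0 by rewrite mxrank0.
  apply/trmx_inj/row_matrixP=> j; rewrite -tr_col trmx0 row0.
  by apply/eqP; rewrite trmx_eq0 -[_ == _]negbK Pl.
set x := col j (P l) in Pj; have Px : P l *m x = x by rewrite -col_mulmx P_idem.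
pose S (y : 'cV[C]_k) := forall p, avoids0 p -> pathmx l p *m y \in <[x]>%VS.
have Slin a y z : S y -> S z -> S (a *: y + z).
  by move=> Sy Sz p p0; rewrite mulmxDr -scalemxAr rpredD ?rpredZ ?Sy ?Sz.
have SP i y : S y -> S (P i *m y).
  move=> Sy p p0; rewrite mulmxA pathmx_mul_proj; case: ifP => _; first exact: Sy.
  by rewrite mul0mx rpred0.
have SA i y : S y -> S (tnth A i *m y).
  move=> Sy; have [i_gt0|/letter0_span[a ->]] := boolP (0 < i)%N; last first.
    move=> p p0; rewrite mulmx_suml mulmx_sumr rpred_sum // => j' _.
    by rewrite -scalemxAl -scalemxAr rpredZ // SP.
  (* Inserting the sum of the projections after the letter gives a sum of walks with one more
     step. *)
  move=> p p0; rewrite mulmxA -[_ *m tnth A i]mulmx1 -P_sum mulmx_sumr mulmx_suml.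
  rewrite rpred_sum // => j' _.
  have -> : pathmx l p *m tnth A i *m P j' = pathmx l (rcons p (i, j')).
    by rewrite -cats1 pathmx_cat /= !mulmxA pathmx_mul_proj eqxx.
  by apply: Sy; rewrite /avoids0 all_rcons /= i_gt0.
have Sx : S x.
  move=> p p0; rewrite -Px mulmxA pathmx_mul_proj.
  case: eqP => [/(loop_scalar p0)[c ->]|_]; last by rewrite mul0mx rpred0.
  by rewrite -scalemxAl Px rpredZ // memv_line.
pose f i : 'End('cV[C]_k) := linfun (mulmx (tnth A i)).
have fE i y : f i y = tnth A i *m y by rewrite lfunE.
have [|U [xU US Uf]] := @stable_subspace _ _ _ f S x Slin _ Sx.
  by move=> i y Sy; rewrite fE; apply: SA.
exists U; split.
- by apply: contraNneq Pj => U0; move: xU; rewrite U0 memv0.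
(* The empty walk is [P l]; if [U] were everything, all columns of [P l] would lie on the line of
   [x]. *)
- apply: contraTneq rankP => Ufull; rewrite -leqNgt.
  suff : (\rank (P l)^T <= \rank x^T)%N.
    by rewrite mxrank_tr => /leq_trans; apply; apply: rank_leq_row.
  apply/mxrankS/row_subP => i; rewrite -tr_col colE.
  have /vlineP[c ->] : P l *m delta_mx i 0 \in <[x]>%VS.
    by apply: (US _ _ [::]) => //; rewrite Ufull memvf.
  by rewrite linearZ scalemx_sub.
- by move=> i y yU; rewrite A_adj -fE; split; apply: Uf.
Qed.

End Words.

(** * Membership in the extension tuple and eigenvalues on its axes *)

Lemma mem_ext1 (C : numClosedFieldType) (k n r : nat) (A : n.-tuple 'M[C]_k)
    (lam : r.-tuple C) (u : seq 'I_n) (v : seq 'I_r) :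
    size u = (size v).+1 -> all (fun i : 'I_n => 0 < i)%N u -> uniq v ->
    (size v < r)%N ->
  exists s, tnth (ext1 A lam) s =
    wordmx A (fun j => eigenproj A`_0 (tnth lam j)) u v.
Proof.
move=> suv u0 v_uniq vr.
set W := wordmx _ _ _ _; suff /tnthP[s ->] : W \in ext1 A lam by exists s.
(* Words with q = 1 are matrices of [A] itself; the longer ones are in the appended part. *)
rewrite mem_cat; have [v0|v0] := posnP (size v).
  rewrite /W (size0nil v0); rewrite v0 in suv.
  by case: u suv {u0 W} => [|i [|? ?]] //= _; rewrite mem_tnth.
apply/orP; right; apply/flatten_mapP; exists (size u).
  (* Here q = size v + 1, and [iota 2 r.-1] runs over 2 <= q <= r. *)
  by rewrite mem_iota; lia.
have sv : size v == (size u).-1 by rewrite suv.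
apply/allpairsP; exists (in_tuple u, Tuple sv) => /=; split=> //.
  by rewrite mem_filter u0 mem_enum.
by rewrite mem_filter v_uniq mem_enum.
Qed.

Lemma tnth_ext1_lshift (C : numClosedFieldType) (k n r : nat)
    (A : n.-tuple 'M[C]_k) (lam : r.-tuple C) (i : 'I_n) :
  tnth (ext1 A lam) (lshift _ i) = tnth A i.
Proof. by rewrite (tnth_nth 0) /= nth_cat size_tuple ltn_ord -tnth_nth. Qed.

Lemma eigenvalue_unit_neq0 (F : fieldType) (k : nat) (M : 'M[F]_k) (a : F) :
  M \in unitmx -> eigenvalue M a -> a != 0.
Proof.
move=> Mu /eigenvalueP[v ve v0]; apply: contraNneq v0 => a0.
by rewrite -[v](mulmxK Mu) ve a0 scale0r mul0mx.
Qed.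

(** Shows that a component meets an axis only at inverses of eigenvalues, the points where stability
    applies. *)
Lemma component_axis_eigenvalue (C : numClosedFieldType) (k N : nat)
    (B : N.-tuple 'M[C]_k) (p q : {mpoly C[N.+1]}) (i : 'I_N) (c : C) :
    joint_charpoly B = p * q -> component p (axis_point i c) ->
  eigenvalue (tnth B i) c^-1.
Proof.
rewrite /component meval_dehom => Bpq pc.
have := meval_joint_charpoly B (-1) (axis_point i c).
rewrite Bpq mevalM pc mul0r sum_axis_point => /esym/eqP/det0P[v v0 e].
have {}e : c *: (v *m tnth B i) = v.
  by move/eqP: e; rewrite mulmxDr scaleN1r mulmxN mulmx1 addrC subr_eq0 -scalemxAr => /eqP.
apply/eigenvalueP; exists v => //.
have c0 : c != 0 by apply: contraNneq v0 => c0; rewrite -e c0 scale0r.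
by rewrite -{2}e scalerK.
Qed.

Theorem theorem8p10 (R : realType) (k n : nat) (n_ge2 : (2 <= n)%N)
    (A : n.-tuple 'M[R[i]]_k)
    (A_herm : forall i, tnth A i \is hermsymmx)
    (A_unit : forall i, tnth A i \in unitmx)
    (A_adm : admissible A)
    (r : nat) (lam : r.-tuple R[i])
    (lam_eig : distinct_eigenvalues A`_0 lam)
    (m : nat)
    (F : 'I_m -> mpoly (n + size (extension_words A lam)).+1 R[i])
    (t : 'I_m -> nat)
    (F_fact : is_factorization (joint_charpoly (ext1 A lam)) F t)
    (A_stable : spectrally_stable A F)
    (t_not1 : ~ (forall j, t j = 1%N)) :
  reducible A.
Proof.
have [BF F_irr t_gt0 _] := F_fact.
pose i0 : 'I_n := Ordinal (ltnW n_ge2); pose B := ext1 A lam.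
have A0 : A`_0 = tnth A i0 by rewrite (tnth_nth 0).
have M_herm : A`_0 \is hermsymmx by rewrite A0.
pose P j := eigenproj A`_0 (tnth lam j).
have A_adj i : (tnth A i)^t* = tnth A i := herm_adjoint (A_herm i).
have P_adj j : (P j)^t* = P j := eigenproj_adjoint _ _.
have P_idem j : P j *m P j = P j := eigenproj_idem _ _.
have P_ortho j j' : j != j' -> P j *m P j' = 0.
  by move=> jj'; apply: eigenproj_ortho => //; rewrite (inj_eq (tuple_uniqP _ lam_eig.1)).
have P_sum : \sum_j P j = 1%:M := sum_eigenproj M_herm lam_eig.
have lamE l : eigenvalue A`_0 (tnth lam l) by rewrite -lam_eig.2 mem_tnth.
have lam0 l : tnth lam l != 0 by apply: eigenvalue_unit_neq0 (lamE l); rewrite A0.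
have stable l := A_stable i0 (tnth lam l) (eq_ind _ (fun M => eigenvalue M _) (lamE l) _ A0).
have BA : tnth B (lshift _ i0) = A`_0 by rewrite tnth_ext1_lshift A0.
have mulBP l : tnth B (lshift _ i0) *m P l = tnth lam l *: P l.
  by rewrite BA mul_eigenproj.
have mulPB l : P l *m tnth B (lshift _ i0) = tnth lam l *: P l.
  by rewrite BA eigenproj_mul.
have P_id l (y : 'cV_k) : tnth B (lshift _ i0) *m y = tnth lam l *: y -> P l *m y = y.
  by rewrite BA; apply: eigenproj_id.
have word_scalar l u v : size u = (size v).+1 ->
    all (fun i : 'I_n => 0 < i)%N u -> uniq v -> (size v < r)%N ->
    exists c, P l *m wordmx A P u v *m P l = c *: P l.
  move=> suv u0 v_uniq vr; have [s es] := mem_ext1 A lam suv u0 v_uniq vr.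
  have [||||s' es'] := @mem_ext1 _ _ _ _ A lam (rev u) (rev v).
  - by rewrite !size_rev.
  - by rewrite all_rev.
  - by rewrite rev_uniq.
  - by rewrite size_rev.
  rewrite -(wordmx_adjoint A_adj P_adj suv) in es'.
  set W := wordmx _ _ _ _ in es es' *.
  have [j [Fj Fj_uniq Fj_simple]] := stable l.
  have scal w Pw := normal_compression_scalar BF (lam0 l) Fj Fj_uniq Fj_simple
    (P_idem l) (mulBP l) (mulPB l) (P_id l) (w := w) (P_adj l) Pw (t_gt0 j).
  pose d w := \sum_(i < _) w i *: tnth B i.
  (* [normal_compression_scalar] needs normal compressions, so [W] is split into [W + W^t*] and
     [W - W^t*], whose compressions are Hermitian and skew-Hermitian. *)
  have dD : d (fun i => axis_point s 1 i + axis_point s' 1 i) = W + W^t*.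
    rewrite /d; under eq_bigr do rewrite scalerDl.
    by rewrite big_split /= !sum_axis_point !scale1r es es'.
  have dB : d (fun i => axis_point s 1 i - axis_point s' 1 i) = W - W^t*.
    rewrite /d; under eq_bigr do rewrite scalerBl.
    by rewrite sumrB !sum_axis_point !scale1r es es'.
  have [|c1] := scal (fun i => axis_point s 1 i + axis_point s' 1 i).
    apply/normalmxP; rewrite -/(d _) dD.
    have -> : (P l *m (W + W^t*) *m P l)^t* = P l *m (W + W^t*) *m P l; last by [].
    rewrite !adjointM P_adj mulmxA; congr (_ *m _ *m _).
    by apply/matrixP=> a b; rewrite !mxE rmorphD /= conjCK addrC.
  have [|c2] := scal (fun i => axis_point s 1 i - axis_point s' 1 i).
    apply/normalmxP; rewrite -/(d _) dB.
    have -> : (P l *m (W - W^t*) *m P l)^t* = - (P l *m (W - W^t*) *m P l).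
      rewrite !adjointM P_adj mulmxA -mulNmx -mulmxN; congr (_ *m _ *m _).
      by apply/matrixP=> a b; rewrite !mxE rmorphB /= conjCK opprB.
    by rewrite mulNmx mulmxN.
  rewrite -!/(d _) dD dB => e2 e1; exists ((c1 + c2) / 2).
  apply: (scalerI (a := 2)); first by rewrite pnatr_eq0.
  rewrite scalerA mulrC divfK ?pnatr_eq0 // [RHS]scalerDl -e1 -e2.
  rewrite -[in RHS]mulmxDl -mulmxDr addrACA addrN addr0 [LHS]scaler_nat [LHS]mulr2n.
  by rewrite mulmxDr mulmxDl.
(* A factor of multiplicity above 1 meets the first axis at some 1/lambda_l; stability makes it the
   only factor vanishing there, so its multiplicity is the rank of [P l]. *)
have /forallPn[j tj1] : ~~ [forall j, t j == 1%N].
  by apply/negP => /forallP t1; apply: t_not1 => j; apply/eqP.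
have [q Bq] : exists q, joint_charpoly B = F j * q.
  rewrite BF (bigD1 j) //=; have := t_gt0 j; case: (t j) => // tj _.
  by rewrite exprS -mulrA; eexists.
have [|c Fc] := component_meets_axis (i := lshift _ i0) _ (F_irr j) Bq.
  by rewrite tnth_ext1_lshift.
have := component_axis_eigenvalue Bq Fc; rewrite BA -lam_eig.2 => /tnthP[l cl].
have [j' [Fj Fj_uniq Fj_simple]] := stable l.
have jj' : j = j' by apply: Fj_uniq; rewrite -cl invrK.
apply: (@reducible_of_rank _ _ _ _ A P A_adj P_idem P_ortho word_scalar _ P_sum l).
  (* The spectral decomposition of the first matrix, with its eigenvalues as coefficients. *)
  move=> i; rewrite -eqn0Ngt => /eqP i_0; exists (tnth lam).
  have -> : tnth A i = A`_0 by rewrite A0; congr tnth; apply: val_inj.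
  rewrite -[LHS]mulmx1 -P_sum mulmx_sumr; apply: eq_bigr => l' _.
  exact: mul_eigenproj.
rewrite -(multiplicity_eq_rank BF (lam0 l) Fj Fj_uniq Fj_simple
    (P_idem l) (mulPB l) (P_id l)) -jj'.
by rewrite ltn_neqAle eq_sym tj1 t_gt0.
Qed.
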